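(* Let $A$ be a ring (associative with identity) and let $G(A_A)$ denote the right Goldie radical of $A$. The following conditions are equivalent: (1) every automorphism-invariant non-singular right $A$-module is injective; (2) the factor ring $A/G(A_A)$ is a right strongly semiprime ring.
   Context: All modules are unitary right modules. A module $M$ is automorphism-invariant if $M$ is invariant under every automorphism of its injective hull. For a right $A$-module $X$, $\operatorname{Sing} X$ is the set of $x\in X$ whose right annihilator $r(x)$ is an essential right ideal of $A$; $X$ is non-singular if $\operatorname{Sing} X=0$. The Goldie radical $G(X)$ of $X$ is the intersection of all submodules $Y\subseteq X$ such that $X/Y$ is non-singular; $G(A_A)$ is a two-sided ideal of $A$. A ring $R$ is right strongly semiprime if every two-sided ideal of $R$ that is essential as a right ideal contains a finite subset whose right annihilator in $R$ is zero. *)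

(* Defs.v *)
From HB Require Import structures.
From mathcomp Require Import all_boot all_order all_algebra.
Set Implicit Arguments. Unset Strict Implicit. Unset Printing Implicit Defensive.
Import GRing.Theory.
Local Open Scope ring_scope.

(* Conventions: a right A-module is a left module over the converse ring A^c
   (x . a := a *: x, and (x . a) . b = x . (a * b) in A).
   The regular right module A_A is (A^c)^o. Subsets are Prop predicates. *)

Section ModDefs.
Variable R : pzRingType.

Definition submod (X : lmodType R) (S : X -> Prop) : Prop :=
  S 0 /\ (forall x y, S x -> S y -> S (x + y)) /\ (forall (r : R) x, S x -> S (r *: x)).

Definition essential (X : lmodType R) (S : X -> Prop) : Prop :=
  submod S /\
  forall T : X -> Prop, submod T -> (exists t, T t /\ t <> 0) ->
    exists x, S x /\ T x /\ x <> 0.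

(* Sing X : elements whose annihilator is an essential ideal of the ring
   (with R = A^c, essential submodules of R^o = essential right ideals of A) *)
Definition sing_elt (X : lmodType R) (x : X) : Prop :=
  essential (fun r : R^o => @GRing.scale R X r x = 0).

Definition nonsingular (X : lmodType R) : Prop :=
  forall x : X, sing_elt x -> x = 0.

(* X/Y is non-singular, written out for the quotient module: an element
   x + Y of X/Y is singular iff {r | r x in Y} is essential, and it is zero
   iff x \in Y. *)
Definition quot_nonsingular (X : lmodType R) (Y : X -> Prop) : Prop :=
  forall x : X, essential (fun r : R^o => Y (@GRing.scale R X r x)) -> Y x.

Definition goldie_rad (X : lmodType R) (x : X) : Prop :=
  forall Y : X -> Prop, submod Y -> quot_nonsingular Y -> Y x.

Definition injective_mod (M : lmodType R) : Prop :=
  forall (X Y : lmodType R) (i : {linear X -> Y}) (f : {linear X -> M}),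
    injective i -> exists g : {linear Y -> M}, forall x, g (i x) = f x.

Definition injective_hull (M E : lmodType R) (f : {linear M -> E}) : Prop :=
  injective_mod E /\ injective f /\ essential (fun e : E => exists m, f m = e).

Definition auto_invariant (M : lmodType R) : Prop :=
  forall (E : lmodType R) (f : {linear M -> E}), injective_hull f ->
    forall g : {linear E -> E}, bijective g ->
      forall m : M, exists m' : M, g (f m) = f m'.

End ModDefs.

Definition two_sided_ideal (B : pzRingType) (I : B -> Prop) : Prop :=
  I 0 /\ (forall x y, I x -> I y -> I (x + y)) /\
  (forall a x, I x -> I (a * x)) /\ (forall a x, I x -> I (x * a)).

Definition right_strongly_semiprime (B : pzRingType) : Prop :=
  forall I : B -> Prop, two_sided_ideal I ->
    essential (fun b : (B^c)^o => I b) ->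
    exists s : seq B, (forall x, x \in s -> I x) /\
      (forall b : B, (forall x, x \in s -> x * b = 0) -> b = 0).

(* Main.v *)
Require Import Defs.
From HB Require Import structures.
From mathcomp Require Import all_boot all_order all_algebra.
From mathcomp Require Import generic_quotient ring_quotient.
From mathcomp Require Import boolp classical_sets.
Set Implicit Arguments. Unset Strict Implicit. Unset Printing Implicit Defensive.
Import GRing.Theory.
Local Open Scope ring_scope.
Local Open Scope quotient_scope.

(* Work with left modules over R; the theorem is the case R = A^c.

   If (2) holds and N is a fully invariant essential submodule of a
   non-singular injective module E, then N = E: the ideal I = {a | a E <= N} is
   essential, and if x_1, ..., x_n in I have zero left annihilator modulo G,
   then any e in E can be written as sum x_i e_i in N, by extending the map
   (b x_i)_i |-> b e. For an automorphism-invariant M with hull E, apply this to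
   the largest fully invariant submodule M0 of M, once M0 is known to be
   essential. If M0 misses R m with m in M, then R m contains neither a uniform
   submodule nor a direct sum of two isomorphic non-zero submodules, because
   automorphisms of E suffice to show that every endomorphism of E maps such
   submodules into M. A maximal fully invariant N containing all e orthogonal to
   m but not m itself is then essential, so N = E, which is absurd.

   Conversely, for I essential and E the hull of R / G, the fully invariant
   submodule I E of E is automorphism-invariant, hence injective, hence equal to
   E; writing 1 + G as an element of I E yields the finite subset of I. *)

(** * Submodules and quotients of a module as modules *)

Section SubmoduleQuotient.
Variables (R : pzRingType) (X : lmodType R) (S : X -> Prop).
Hypothesis HS : submod S.

(** The proof argument ties the predicate to [HS], so that the closure instance can be attached to
    it. *)
Definition submod_pred of submod S : {pred X} := [pred x | `[<S x>]].

Let submod_pred_closed : submod_closed (submod_pred HS).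
Proof.
have [S0 [SD SZ]] := HS; split => [|r x y]; first by apply/asboolP.
by move=> /asboolP Sx /asboolP Sy; apply/asboolP/SD => //; apply: SZ.
Qed.
HB.instance Definition _ := GRing.isSubmodClosed.Build R X (submod_pred HS) submod_pred_closed.

Definition submodule := {x | submod_pred HS x}.
HB.instance Definition _ := SubChoice.on submodule.
HB.instance Definition _ := [SubChoice_isSubLmodule of submodule by <:].

Lemma submodule_exists :
  exists (U : lmodType R) (i : {linear U -> X}),
    injective i /\ forall x, S x <-> exists u, i u = x.
Proof.
exists submodule, (val : {linear submodule -> X}); split; first exact: val_inj.
move=> x; split => [Sx|[u <-]]; last by case: u => u /= /asboolP.
by exists (exist _ x (introT (asboolP _) Sx)).
Qed.

Definition quotient := Quotient.quot (submod_pred HS).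
Local Notation Q := quotient.
HB.instance Definition _ := GRing.Zmodule.on quotient.
Let scaleQ (a : R) (q : Q) : Q := \pi_Q (a *: repr q).

Let piZ a x : scaleQ a (\pi_Q x) = (\pi_Q (a *: x)).
Proof.
rewrite /scaleQ; apply/eqP; rewrite -Quotient.idealrBE -scalerBr rpredZ //.
by rewrite Quotient.idealrBE reprK.
Qed.

Let piD x y : (\pi_Q x + \pi_Q y = \pi_Q (x + y)).
Proof. by rewrite raddfD. Qed.

Let scaleQA a b v : scaleQ a (scaleQ b v) = scaleQ (a * b) v.
Proof. by elim/quotW: v => v; rewrite (piZ b v) !piZ scalerA. Qed.
Let scaleQ1 : left_id 1 scaleQ.
Proof. by move=> q; elim/quotW: q => v; rewrite piZ scale1r. Qed.
Let scaleQDr : right_distributive scaleQ +%R.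
Proof.
move=> a p q; elim/quotW: p => u; elim/quotW: q => v.
by rewrite piD !piZ piD scalerDr.
Qed.
Let scaleQDl v : {morph scaleQ^~ v : a b / a + b}.
Proof. by elim/quotW: v => v a b; rewrite !piZ scalerDl piD. Qed.

HB.instance Definition _ :=
  GRing.Zmodule_isLmodule.Build R Q scaleQA scaleQ1 scaleQDr scaleQDl.

Lemma quotient_exists :
  exists (U : lmodType R) (p : {linear X -> U}),
    (forall u, exists x, p x = u) /\ forall x, p x = 0 <-> S x.
Proof.
have plin : linear (\pi_Q : X -> Q).
  by move=> a x y; rewrite /= -piD -piZ.
pose pm := GRing.isLinear.Build R X Q _ _ plin.
pose p : {linear X -> Q} := HB.pack (\pi_Q : X -> Q) pm.
exists Q, p; split; first by move=> q; elim/quotW: q => x; exists x.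
move=> x; have -> : p x = (\pi_Q x) by [].
split => [/eqP|Sx].
  by rewrite -(raddf0 (\pi_Q)) -Quotient.idealrBE subr0 => /asboolP.
apply/eqP; rewrite -(raddf0 (\pi_Q)) -Quotient.idealrBE subr0; exact/asboolP.
Qed.
End SubmoduleQuotient.

(** * The factor ring by a two-sided ideal *)

Section RingQuotient.
Variables (A : pzRingType) (I : A -> Prop).
Hypothesis HI : two_sided_ideal I.

Definition ideal_pred of two_sided_ideal I : {pred A} := [pred x | `[<I x>]].

Let ideal_pred_closed : zmod_closed (ideal_pred HI).
Proof.
have [S0 [SD [SZ _]]] := HI; split => [|x y]; first by apply/asboolP.
move=> /asboolP Sx /asboolP Sy; apply/asboolP/SD => //.
by rewrite -mulN1r; apply: SZ.
Qed.
HB.instance Definition _ := GRing.isZmodClosed.Build A (ideal_pred HI) ideal_pred_closed.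

Definition quotient_ring := Quotient.quot (ideal_pred HI).
Local Notation Q := quotient_ring.
HB.instance Definition _ := GRing.Zmodule.on quotient_ring.
Let mulQ (a b : Q) : Q := \pi_Q (repr a * repr b).

Let piM x y : mulQ (\pi_Q x) (\pi_Q y) = (\pi_Q (x * y)).
Proof.
rewrite /mulQ; apply/eqP; rewrite -Quotient.idealrBE.
set x' := repr _; set y' := repr _.
have ex : x' - x \in ideal_pred HI by rewrite Quotient.idealrBE reprK.
have ey : y' - y \in ideal_pred HI by rewrite Quotient.idealrBE reprK.
have -> : x' * y' - x * y = (x' - x) * y' + x * (y' - y).
  by rewrite mulrBl mulrBr addrA subrK.
have [_ [ID [IMl IMr]]] := HI.
by apply/asboolP/ID; [apply/IMr/asboolP|apply/IMl/asboolP].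
Qed.

Let piD x y : (\pi_Q x + \pi_Q y = \pi_Q (x + y)).
Proof. by rewrite raddfD. Qed.

Let mulQA : associative mulQ.
Proof.
move=> p q r; elim/quotW: p => u; elim/quotW: q => v; elim/quotW: r => w.
by rewrite (piM v w) (piM u v) !piM mulrA.
Qed.
Let mul1Q : left_id (\pi_Q 1) mulQ.
Proof. by move=> q; elim/quotW: q => v; rewrite piM mul1r. Qed.
Let mulQ1 : right_id (\pi_Q 1) mulQ.
Proof. by move=> q; elim/quotW: q => v; rewrite piM mulr1. Qed.
Let mulQDl : left_distributive mulQ +%R.
Proof.
move=> p q r; elim/quotW: p => u; elim/quotW: q => v; elim/quotW: r => w.
by rewrite piD !piM piD mulrDl.
Qed.
Let mulQDr : right_distributive mulQ +%R.
Proof.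
move=> p q r; elim/quotW: p => u; elim/quotW: q => v; elim/quotW: r => w.
by rewrite piD !piM piD mulrDr.
Qed.

HB.instance Definition _ :=
  GRing.Zmodule_isPzRing.Build Q mulQA mul1Q mulQ1 mulQDl mulQDr.

Lemma quotient_ring_exists :
  exists (B : pzRingType) (p : {rmorphism A -> B}),
    (forall b, exists a, p a = b) /\ forall a, p a = 0 <-> I a.
Proof.
have padd : zmod_morphism (\pi_Q : A -> Q) by move=> x y; rewrite raddfB.
have pmul : monoid_morphism (\pi_Q : A -> Q) by split=> // x y; rewrite -piM.
pose pa := GRing.isZmodMorphism.Build A Q _ padd.
pose pm := GRing.isMonoidMorphism.Build A Q _ pmul.
pose p : {rmorphism A -> Q} := HB.pack (\pi_Q : A -> Q) pa pm.
exists Q, p; split; first by move=> q; elim/quotW: q => x; exists x.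
move=> x; have -> : p x = (\pi_Q x) by [].
split => [/eqP|Sx].
  by rewrite -(raddf0 (\pi_Q)) -Quotient.idealrBE subr0 => /asboolP.
apply/eqP; rewrite -(raddf0 (\pi_Q)) -Quotient.idealrBE subr0; exact/asboolP.
Qed.
End RingQuotient.

(** * Essential submodules, non-singularity and injectivity *)

Section Modules.
Variable R : pzRingType.
Implicit Types X Y E : lmodType R.

Lemma linear_pack X Y (f : X -> Y) :
  linear f -> exists g : {linear X -> Y}, forall x, g x = f x.
Proof.
move=> flin; pose m := GRing.isLinear.Build R X Y _ _ flin.
by exists (HB.pack f m : {linear X -> Y}).
Qed.

Lemma submodN X (S : X -> Prop) x : submod S -> S x -> S (- x).
Proof. by move=> [_ [_ SZ]] Sx; rewrite -scaleN1r; apply: SZ. Qed.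

Lemma submodB X (S : X -> Prop) x y : submod S -> S x -> S y -> S (x - y).
Proof. by move=> HS Sx Sy; apply: HS.2.1 => //; apply: submodN. Qed.

Lemma submod_ker X Y (f : {linear X -> Y}) : submod (fun x => f x = 0).
Proof.
split; first by rewrite linear0.
split=> [x y fx fy|r x fx]; first by rewrite linearD fx fy addr0.
by rewrite linearZ_LR fx scaler0.
Qed.

Lemma submod_preim X Y (f : {linear X -> Y}) (S : Y -> Prop) :
  submod S -> submod (fun x => S (f x)).
Proof.
move=> [S0 [SD SZ]]; split; first by rewrite linear0.
split=> [x y fx fy|r x fx]; first by rewrite linearD; apply: SD.
by rewrite linearZ_LR; apply: SZ.
Qed.

Lemma submod_img X Y (f : {linear X -> Y}) : submod (fun y => exists x, f x = y).
Proof.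
split; first by exists 0; rewrite linear0.
split=> [_ _ [x <-] [y <-]|r _ [x <-]]; first by exists (x + y); rewrite linearD.
by exists (r *: x); rewrite linearZ_LR.
Qed.

Lemma submod_add X (S T : X -> Prop) :
  submod S -> submod T ->
  submod (fun x => exists s t, [/\ S s, T t & x = s + t]).
Proof.
move=> [S0 [SD SZ]] [T0 [TD TZ]]; split; first by exists 0, 0; rewrite addr0.
split=> [_ _ [s [t [Ss Tt ->]]] [s' [t' [Ss' Tt' ->]]]|r _ [s [t [Ss Tt ->]]]].
  by exists (s + s'), (t + t'); split; [exact: SD|exact: TD|rewrite addrACA].
by exists (r *: s), (r *: t); split; [exact: SZ|exact: TZ|rewrite scalerDr].
Qed.

Definition cyclic X (x : X) : X -> Prop := fun y => exists r : R, r *: x = y.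

Lemma scale_linear X (x : X) :
  exists f : {linear R^o -> X}, forall r, f r = (r : R) *: x.
Proof.
by apply: linear_pack => a u v; rewrite scalerDl [a *: u]/(a * u) -scalerA.
Qed.

Lemma submod_cyclic X (x : X) : submod (cyclic x).
Proof.
have [f fE] := scale_linear x; have := submod_img f.
by congr submod; apply/funext => y; apply/propext; split=> -[r <-]; exists r; rewrite ?fE.
Qed.

Lemma essential_sub X (S T : X -> Prop) :
  essential S -> submod T -> (forall x, S x -> T x) -> essential T.
Proof.
move=> [_ eS] HT ST; split=> // U HU /(eS U HU) [x [Sx [Ux x0]]].
by exists x; split; first exact: ST.
Qed.

Lemma essential_cap X (S T : X -> Prop) :
  essential S -> essential T -> essential (fun x => S x /\ T x).
Proof.
move=> [[S0 [SD SZ]] eS] [[T0 [TD TZ]] eT]; split.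
  split=> //; split=> [x y [? ?] [? ?]|r x [? ?]]; split; by auto.
move=> U HU nU; have [x [Sx [Ux x0]]] := eS U HU nU.
have [y [Ty [[r rx] y0]]] := eT (cyclic x) (submod_cyclic x)
  (ex_intro _ x (conj (ex_intro _ 1 (scale1r x)) x0)).
exists y; rewrite -rx in Ty y0 *; split; first by split=> //; exact: SZ.
by split=> //; exact: HU.2.2.
Qed.

Lemma essential_preim X Y (f : {linear X -> Y}) (S : Y -> Prop) :
  essential S -> essential (fun x => S (f x)).
Proof.
move=> [HS eS]; split; first exact: submod_preim.
move=> T HT [t [Tt t0]]; have [ft|ft] := pselect (f t = 0).
  by exists t; rewrite ft; split=> //; exact: HS.1.
have [|y [Sy [[r rt] y0]]] := eS _ (submod_cyclic (f t)).
  by exists (f t); split=> //; exists 1; rewrite scale1r.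
exists (r *: t); rewrite linearZ_LR rt; split=> //.
split; first exact: HT.2.2.
by move=> rt0; apply: y0; rewrite -rt -linearZ_LR rt0 linear0.
Qed.

Lemma essential_colon X (S : X -> Prop) x :
  essential S -> essential (fun r : R^o => S ((r : R) *: x)).
Proof.
move=> eS; have [f fE] := scale_linear x.
by have := essential_preim f eS; congr essential; apply/funext => r; rewrite fE.
Qed.

Lemma submod_colon X (S : X -> Prop) x :
  submod S -> submod (fun r : R^o => S ((r : R) *: x)).
Proof.
move=> eS; have [f fE] := scale_linear x.
by have := submod_preim f eS; congr submod; apply/funext => r; rewrite fE.
Qed.

Lemma submod0 X : submod (fun x : X => x = 0).
Proof.
by split=> //; split=> [x y -> ->|r x ->]; rewrite ?addr0 ?scaler0.
Qed.

(** The working form of non-singularity: an equation in [X] may be tested after multiplication by an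
    essential left ideal. *)
Lemma nonsing_kill X (x : X) (I : R^o -> Prop) : nonsingular X ->
  essential I -> (forall r : R, I r -> r *: x = 0) -> x = 0.
Proof.
move=> nsX eI Ix; apply: nsX; apply: essential_sub eI _ Ix.
exact: (submod_colon x (submod0 X)).
Qed.

(** The annihilator of [x] is not essential, so it misses some non-zero left ideal, and any non-zero
    [c] in that ideal works. By [ext_elem], [c *: x] can then be mapped to [c *: v] for every [v] in
    an injective module. *)
Lemma nonsing_free X (x : X) : nonsingular X -> x <> 0 ->
  exists c : R, c *: x <> 0 /\ forall b : R, b *: (c *: x) = 0 -> b * c = 0.
Proof.
move=> nsX x0; apply: contrapT => Nc; apply: x0; apply: nsX.
split; first exact: (submod_colon x (submod0 X)).
move=> T HT [t [Tt t0]]; apply: contrapT => Nr; apply: Nc.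
have Tx (r : R) : T r -> r *: x = 0 -> r = 0.
  by move=> Tr rx; apply: contrapT => r0; apply: Nr; exists r.
exists t; split; first by move=> /(Tx _ Tt).
by move=> b; rewrite scalerA => /Tx; apply; apply: HT.2.2.
Qed.

Lemma nonsing_sub X Y (f : {linear X -> Y}) :
  nonsingular Y -> injective f -> nonsingular X.
Proof.
move=> nsY finj x sx; apply: finj; rewrite linear0.
by apply: (nonsing_kill nsY sx) => r rx; rewrite -linearZ_LR rx linear0.
Qed.

(** The union of a non-empty chain of good submodules is good. [Phi] is empty for complements and
    maximal partial maps, and consists of all endomorphisms when a fully invariant submodule is
    wanted. *)
Lemma zorn_avoid X (Phi : (X -> X) -> Prop) (Z S0 : X -> Prop) :
  let good S := [/\ submod S, forall f x, Phi f -> S x -> S (f x),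
                    forall x, S x -> ~ Z x & forall x, S0 x -> S x] in
  good S0 -> exists S, good S /\ forall T, good T -> (forall x, S x -> T x) ->
    forall x, T x -> S x.
Proof.
move=> good gS0; pose P : set (set X) := fun S => S = set0 \/ good S.
have [F FP Ftot|A [PA maxA]] := @Zorn_bigcup X P.
  have [[A [FA A0]]|NA] := pselect (exists A, F A /\ good A); last first.
    left; apply/seteqP; split=> // x [A FA Ax].
    by case: (FP A FA) => [A0|gA]; [rewrite A0 in Ax|case: NA; exists A].
  have gF B x : F B -> B x -> good B.
    by move=> /FP [->|] //.
  right; split.
  - split; first by exists A => //; case: A0 => -[].
    split=> [x y [B FB Bx] [C FC Cy]|r x [B FB Bx]].
      have [[[_ [BD _]] _ _ _] [[_ [CD _]] _ _ _]] := (gF _ _ FB Bx, gF _ _ FC Cy).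
      by case: (Ftot B C FB FC) => [BC|CB]; [exists C => //; apply/CD => //; exact: BC|
        exists B => //; apply/BD => //; exact: CB].
    by exists B => //; have [[_ [_ BZ]] _ _ _] := gF _ _ FB Bx; apply: BZ.
  - move=> f x Pf [B FB Bx]; exists B => //.
    by have [_ Bf _ _] := gF _ _ FB Bx; apply: Bf.
  - by move=> x [B FB Bx]; have [_ _ BZ _] := gF _ _ FB Bx; apply: BZ.
  - by move=> x S0x; exists A => //; case: A0 => _ _ _; apply.
have gA : good A.
  case: PA => // A0; case: (maxA S0); last by right.
  rewrite A0; split=> // S0s; have [[S00 _] _ _ _] := gS0.
  exact: (S0s 0 S00).
exists A; split=> // T gT AT x Tx; apply: contrapT => NAx.
by apply: (maxA T); [split=> // TA; apply/NAx/TA|right].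
Qed.

Lemma max_avoid X (Z S0 : X -> Prop) :
  submod S0 -> (forall x, S0 x -> ~ Z x) ->
  exists S : X -> Prop, [/\ submod S, forall x, S x -> ~ Z x,
    forall x, S0 x -> S x &
    forall T, submod T -> (forall x, S x -> T x) -> (forall x, T x -> ~ Z x) ->
      forall x, T x -> S x].
Proof.
move=> HS0 S0Z; have [|S [[HS _ SZ S0S] maxS]] := @zorn_avoid X (fun=> False) Z S0.
  by split.
exists S; split=> // T HT ST TZ; apply: maxS => //; split=> // x S0x.
exact/ST/S0S.
Qed.

(** For a submodule [W] this says that [W] is the graph of a homomorphism from a submodule of [X] to
    [E]. *)
Definition functional X E (W : X * E -> Prop) := forall v, W (0, v) -> v = 0.

Lemma functional_eq X E (W : X * E -> Prop) x u v : submod W -> functional W ->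
  W (x, u) -> W (x, v) -> u = v.
Proof.
move=> HW fW Wu Wv; apply/eqP; rewrite -subr_eq0; apply/eqP/fW.
by have := submodB HW Wu Wv; rewrite /GRing.add /= /add_pair /= subrr.
Qed.

(** Being functional amounts to avoiding the pairs [(0, v)] with [v <> 0], so [max_avoid]
    applies. *)
Lemma max_functional X E (W0 : X * E -> Prop) : submod W0 -> functional W0 ->
  exists W : X * E -> Prop, [/\ submod W, functional W, forall p, W0 p -> W p &
    forall T : X * E -> Prop, submod T -> functional T ->
      (forall p, W p -> T p) -> forall p, T p -> W p].
Proof.
move=> HW fW.
have [//|x W0x [x1 x2]|W [HW1 WZ W0W maxW]] :=
    @max_avoid _ (fun p : X * E => p.1 = 0 /\ p.2 <> 0) W0.
  by case: x W0x x1 x2 => x v /= + x0; rewrite x0 => /fW.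
exists W; split=> //.
  by move=> v Wv; apply: contrapT => v0; apply: (WZ _ Wv).
move=> T HT fT WT; apply: maxW => // -[x v] Txv /= [x0]; apply.
by rewrite x0 in Txv; apply: fT.
Qed.

(** The first projection embeds [W] into [X] because [W] is functional; the second projection is
    extended along this embedding. *)
Lemma ext_functional X E (W : X * E -> Prop) :
  injective_mod E -> submod W -> functional W ->
  exists g : {linear X -> E}, forall x v, W (x, v) -> g x = v.
Proof.
move=> injE HW fW; have [U [i [iinj Wi]]] := submodule_exists HW.
have [f1 f1E] : exists f : {linear U -> X}, forall u, f u = (i u).1.
  by apply: linear_pack => a u v; rewrite linearD linearZ_LR.
have [f2 f2E] : exists f : {linear U -> E}, forall u, f u = (i u).2.
  by apply: linear_pack => a u v; rewrite linearD linearZ_LR.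
have f1inj : injective f1.
  move=> u v; rewrite !f1E => uv; apply: iinj.
  have Wu : W (i u) by apply/Wi; exists u.
  have Wv : W (i v) by apply/Wi; exists v.
  move: uv Wu Wv; case: (i u) => x y; case: (i v) => x' y' /= -> Wu Wv.
  by rewrite (functional_eq HW fW Wu Wv).
have [g gE] := injE _ _ f1 f2 f1inj.
exists g => x v /Wi [u iu]; have := gE u; by rewrite f1E f2E iu.
Qed.

Lemma ext_elem X E (x : X) (e : E) : injective_mod E ->
  (forall a : R, a *: x = 0 -> a *: e = 0) -> exists g : {linear X -> E}, g x = e.
Proof.
move=> injE xe; pose W (p : X * E) := cyclic (x, e) p.
have [|v [r /pair_equal_spec [rx re]]|g gE] := ext_functional (W := W) injE.
- exact: submod_cyclic.
- by rewrite -re; apply: xe.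
by exists g; apply: gE; exists 1; rewrite scale1r.
Qed.

(* Baer's criterion, with partial homomorphisms presented by their graphs. *)
Lemma baer E :
  (forall V : R^o * E -> Prop, submod V -> functional V ->
     exists e : E, forall (r : R) v, V (r, v) -> v = r *: e) ->
  injective_mod E.
Proof.
move=> H X Y i f iinj.
pose W0 (p : Y * E) := exists x, i x = p.1 /\ f x = p.2.
have HW0 : submod W0.
  split; first by exists 0; rewrite !linear0.
  split=> [p q [x [x1 x2]] [y [y1 y2]]|r p [x [x1 x2]]].
    by exists (x + y); rewrite !linearD x1 x2 y1 y2.
  by exists (r *: x); rewrite !linearZ_LR x1 x2.
have fW0 : functional W0.
  move=> v [x /= [ix fx]]; rewrite -fx.
  have -> : x = 0 by apply: iinj; rewrite linear0.
  by rewrite linear0.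
have [W [HW fW W0W maxW]] := max_functional HW0 fW0.
have totW y : exists v, W (y, v).
  (* [V] is the partial map that [W] induces on the left ideal carrying [y] into the domain of [W].
     If [e] represents it, adjoining [(y, e)] keeps [W] functional, so maximality puts [y] in the
     domain. *)
  pose V (p : R^o * E) := W ((p.1 : R) *: y, p.2).
  have HV : submod V.
    split; first by rewrite /V /= scale0r; exact: HW.1.
    split=> [p q Vp Vq|r p Vp].
      by have := HW.2.1 _ _ Vp Vq; rewrite /V /= scalerDl.
    by have := HW.2.2 r _ Vp; rewrite /V /= -scalerA.
  have [|e eV] := H V HV; first by move=> v; rewrite /V /= scale0r => /fW.
  pose W' (p : Y * E) := exists s t, [/\ W s, cyclic (y, e) t & p = s + t].
  exists e; apply: (maxW W').
  - by apply: submod_add => //; exact: submod_cyclic.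
  - move=> v [[z w] [_ [Wzw [r <-] /pair_equal_spec [/= zr ->]]]].
    have zE : z = (- r) *: y by rewrite scaleNr; apply/eqP; rewrite -addr_eq0 -zr.
    by rewrite (eV (- r) w) ?scaleNr ?addNr // /V /= -zE.
  - move=> p Wp; exists p, 0; rewrite addr0; split=> //; exists 0.
    by rewrite scale0r.
  - exists 0, (y, e); rewrite add0r; split=> //; first exact: HW.1.
    by exists 1; rewrite scale1r.
pose g y := projT1 (cid (totW y)).
have gW y : W (y, g y) by rewrite /g; case: cid.
have Weq y v : W (y, v) -> g y = v by exact: functional_eq (gW y).
have [h hE] : exists h : {linear Y -> E}, forall y, h y = g y.
  apply: linear_pack => a u v; apply: Weq.
  exact: (HW.2.1 _ _ (HW.2.2 a _ (gW u)) (gW v)).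
by exists h => x; rewrite hE; apply/Weq/W0W; exists x.
Qed.

(** A submodule [C] containing [Y] and maximal with zero intersection with [X] makes [X + C]
    essential. The projection of [X + C] onto [X] extends to [p], whose values are carried into [X]
    by essential left ideals; non-singularity then gives idempotence. *)
Lemma projection E (X Y : E -> Prop) : injective_mod E -> nonsingular E ->
  submod X -> submod Y -> (forall x, X x -> Y x -> x = 0) ->
  exists p : {linear E -> E},
    [/\ forall x, X x -> p x = x, forall y, Y y -> p y = 0,
        forall e, essential (fun r : R^o => X ((r : R) *: p e)) &
        forall e, p (p e) = p e].
Proof.
move=> injE nsE HX HY XY.
have [//|y Yy [Xy y0]|C [HC CZ YC maxC]] :=
    @max_avoid _ (fun x => X x /\ x <> 0) Y.
  by apply/y0/XY.
have XC x : X x -> C x -> x = 0.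
  by move=> Xx Cx; apply: contrapT => x0; apply: (CZ x Cx).
pose XpC x := exists s t, [/\ X s, C t & x = s + t].
have HXpC : submod XpC by exact: submod_add.
have eXpC : essential XpC.
  split=> // T HT [t [Tt t0]]; apply: contrapT => NT.
  have T0 x : T x -> XpC x -> x = 0.
    by move=> Tx XCx; apply: contrapT => x0; apply: NT; exists x.
  apply: t0; apply: (T0) => //; exists 0, t; rewrite add0r; split=> //; first exact: HX.1.
  (* Since [T] meets [X + C] trivially, [C + T] still meets [X] trivially, so maximality puts [T]
     inside [C]. *)
  apply: (maxC (fun x => exists s t, [/\ C s, T t & x = s + t])).
  - exact: submod_add.
  - by move=> x Cx; exists x, 0; rewrite addr0; split=> //; exact: HT.1.
  - move=> x [c [u [Cc Tu xE]]] [Xx]; apply.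
    have u0 : u = 0.
      apply: T0 => //; exists x, (- c); split=> //; first exact: submodN.
      by rewrite xE addrAC subrr add0r.
    by apply: XC => //; rewrite xE u0 addr0.
  - by exists 0, t; rewrite add0r; split=> //; exact: HC.1.
pose W (q : E * E) := exists x c, [/\ X x, C c & q = (x + c, x)].
have [||p pE] := ext_functional (W := W) injE.
- split; first by exists 0, 0; rewrite addr0; split=> //; [exact: HX.1|exact: HC.1].
  split=> [_ _ [s [t [Xs Ct ->]]] [s' [t' [Xs' Ct' ->]]]|r _ [s [t [Xs Ct ->]]]].
    exists (s + s'), (t + t'); split; [exact: HX.2.1|exact: HC.2.1|].
    by apply: injective_projections; rewrite //= addrACA.
  exists (r *: s), (r *: t); split; [exact: HX.2.2|exact: HC.2.2|].
  by apply: injective_projections; rewrite //= scalerDr.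
- move=> _ [x [c [Xx Cc /pair_equal_spec [xc ->]]]]; apply: XC => //.
  have -> : x = - c by apply/eqP; rewrite -addr_eq0 -xc.
  exact: submodN.
have pX x : X x -> p x = x.
  by move=> Xx; apply: pE; exists x, 0; rewrite addr0; split=> //; exact: HC.1.
have pC c : C c -> p c = 0.
  by move=> Cc; apply: pE; exists 0, c; rewrite add0r; split=> //; exact: HX.1.
have pess e : essential (fun r : R^o => X ((r : R) *: p e)).
  apply: essential_sub (essential_colon e eXpC) _ _; first exact: submod_colon.
  by move=> r [x [c [Xx Cc re]]]; rewrite -linearZ_LR re linearD pX // pC // addr0.
exists p; split=> // [y Yy|e]; first exact/pC/YC.
apply/eqP; rewrite -subr_eq0; apply/eqP; apply: (nonsing_kill nsE (pess e)).
by move=> r Xr; rewrite scalerBr -linearZ_LR pX ?subrr.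
Qed.

End Modules.

(** Condition (2) for [R = A^c], read off in [R] itself by means of ideals above the Goldie radical.
    Since [b * x] is [x * b] in [A], the right annihilator has become a left one. *)
Definition strongly_semiprime_mod_goldie (R : pzRingType) : Prop :=
  forall I : R -> Prop, two_sided_ideal I ->
    (forall a : R, goldie_rad (X := R^o) a -> I a) ->
    essential (fun a : R^o => I a) ->
    exists s : seq R, (forall x, x \in s -> I x) /\
      forall b : R, (forall x, x \in s -> goldie_rad (X := R^o) (b * x)) ->
        goldie_rad (X := R^o) b.

Definition fully_invariant (R : pzRingType) (E : lmodType R) (N : E -> Prop) :=
  submod N /\ forall (f : {linear E -> E}) x, N x -> N (f x).

(** * Fully invariant submodules of a non-singular injective module *)

Section FullyInvariant.
Variables (R : pzRingType) (E : lmodType R).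
Hypotheses (injE : injective_mod E) (nsE : nonsingular E).

(** The annihilator of [e] is one of the submodules intersected in the radical: its quotient is
    isomorphic to the submodule [R e] of [E]. *)
Lemma goldie_kill (e : E) (a : R) : goldie_rad (X := R^o) a -> a *: e = 0.
Proof.
move=> /(_ (fun r : R^o => (r : R) *: e = 0)); apply.
  exact: (submod_colon e (submod0 E)).
move=> x ex; apply: (nonsing_kill nsE ex) => r.
by rewrite scalerA.
Qed.

(** One member [x] is peeled off at a time. On the [b] annihilating the tail, [b * x |-> b *: e] is
    well defined and extends to [g]; then [e - x *: g 1] is killed by every such [b], and the
    induction applies to it. *)
Lemma seq_span (N : E -> Prop) (s : seq R) (e : E) : submod N ->
  (forall x, x \in s -> forall u, N (x *: u)) ->
  (forall b : R, (forall x, x \in s -> b * x = 0) -> b *: e = 0) -> N e.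
Proof.
move=> HN; elim: s e => [|x s IHs] e Ns es.
  by rewrite -[e]scale1r es //; exact: HN.1.
pose W (p : R^o * E) :=
  exists b : R, (forall y, y \in s -> b * y = 0) /\ p = (b * x, b *: e).
have [||g gE] := ext_functional (W := W) injE.
- split; first by exists 0; split=> [y _|]; rewrite ?mul0r ?scale0r.
  split=> [_ _ [b [bs ->]] [c [cs ->]]|r _ [b [bs ->]]].
    exists (b + c); split=> [y ys|]; first by rewrite mulrDl bs // cs // addr0.
    by apply: injective_projections; rewrite /= ?mulrDl ?scalerDl.
  exists (r * b); split=> [y ys|]; first by rewrite -mulrA bs // mulr0.
  by apply: injective_projections; rewrite /= -?mulrA -?scalerA.
- move=> _ [b [bs /pair_equal_spec [bx ->]]]; apply: es => y.
  by rewrite inE => /predU1P[->|/bs].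
have -> : e = (e - x *: g 1) + x *: g 1 by rewrite subrK.
apply: HN.2.1; last by apply: Ns; rewrite mem_head.
apply: IHs => [y ys u|b bs]; first by apply: Ns; rewrite inE ys orbT.
rewrite scalerBr scalerA -linearZ_LR (gE _ (b *: e)) ?subrr //.
by exists b; split=> //; congr pair; rewrite -[LHS]/(b * x * 1) mulr1.
Qed.

Lemma fully_invariant_full (N : E -> Prop) :
  strongly_semiprime_mod_goldie R -> fully_invariant N -> essential N ->
  forall e, N e.
Proof.
move=> ssp [HN Ninv] eN e.
pose I (a : R) := forall u, N (a *: u).
have HI : two_sided_ideal I.
  split; first by move=> u; rewrite scale0r; exact: HN.1.
  split; first by move=> x y Ix Iy u; rewrite scalerDl; exact: HN.2.1.
  split=> [a x Ix|a x Ix] u; rewrite -scalerA; last exact: Ix.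
  exact: HN.2.2.
have GI (a : R) : goldie_rad (X := R^o) a -> I a.
  by move=> Ga u; rewrite goldie_kill //; exact: HN.1.
have eI : essential (fun a : R^o => I a).
  split; first by case: HI => I0 [ID [IZ _]].
  move=> T HT [t0 [Tt0 t00]].
  (* If [T] annihilates [E], it lies in [I]; otherwise some [t *: u] is non-zero and has a non-zero
     multiple in [N]. *)
  have [[t [u [Tt tu]]]|NT] := pselect (exists (t : R) (u : E), T t /\ t *: u <> 0);
    last first.
    exists t0; split=> // u; have -> : (t0 : R) *: u = 0; last exact: HN.1.
    by apply: contrapT => t0u; apply: NT; exists t0, u.
  have [|z [Natu [[a az] atu]]] := eN.2 _ (submod_cyclic (t *: u)).
    by exists (t *: u); split=> //; exists 1; rewrite scale1r.
  rewrite -az in Natu atu.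
  have [c [catu cfree]] := nonsing_free nsE atu.
  exists (c * (a * t)); split; last first.
    split; first by apply: (HT.2.2 c); exact: (HT.2.2 a).
    by move=> cat0; apply: catu; rewrite !scalerA -mulrA cat0 scale0r.
  move=> v.
  (* By the choice of [c], an endomorphism sends [c a t u], which lies in [N], to [c a t v]. *)
  have [|g <-] := @ext_elem R E E (c *: (a *: (t *: u))) ((c * (a * t)) *: v) injE.
    by move=> b /cfree bc; rewrite scalerA mulrA bc mul0r scale0r.
  by apply: Ninv; exact: HN.2.2.
have [s [Is sG]] := ssp I HI GI eI.
apply: (@seq_span N s e HN) => [x /Is|b bs]; first exact.
apply: goldie_kill; apply: sG => x /bs ->.
by move=> Y HY _; exact: HY.1.
Qed.

Lemma projection_hit (X : E -> Prop) (p : {linear E -> E}) (e : E) :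
  essential (fun r : R^o => X ((r : R) *: p e)) -> p e <> 0 ->
  exists r : R, X (r *: p e) /\ r *: p e <> 0.
Proof.
move=> ep pe0; apply: contrapT => N; apply: pe0.
apply: (nonsing_kill nsE ep) => r Xr; apply: contrapT => r0.
by apply: N; exists r.
Qed.

(** * Submodules stable under all automorphisms of [E] *)

Section AutInvariant.
Variable M : E -> Prop.
Hypotheses (HM : submod M)
  (autM : forall g : {linear E -> E}, bijective g -> forall m, M m -> M (g m)).

(** [1 + d] is an automorphism with inverse [1 - d], and [d] is its difference with the identity. *)
Lemma square_zero_stable (d : {linear E -> E}) m :
  (forall e, d (d e) = 0) -> M m -> M (d m).
Proof.
move=> dd Mm; have [g gE] : exists g : {linear E -> E}, forall e, g e = e + d e.
  apply: linear_pack => a u v.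
  by rewrite linearD linearZ_LR scalerDr addrACA.
have -> : d m = g m - m by rewrite gE addrC addKr.
apply: submodB => //; apply: autM => //; exists (fun e => e - d e) => e.
  by rewrite gE linearD dd addr0 addrK.
by rewrite gE linearB dd subr0 subrK.
Qed.

(** [(1 - p) f p] and [p f (1 - p)] have square zero because [p] is idempotent. *)
Lemma corner_stable (p f : {linear E -> E}) m : (forall e, p (p e) = p e) ->
  M m -> M (f (p m) - p (f (p m))) /\ M (p (f (m - p m))).
Proof.
move=> pp Mm; split.
  have [d dE] : exists d : {linear E -> E}, forall e, d e = f (p e) - p (f (p e)).
    apply: linear_pack => a u v.
    by rewrite (linearP p) !(linearP f) (linearP p) opprD scalerBr addrACA.
  rewrite -dE; apply: square_zero_stable => // e.
  have pd : p (d e) = 0 by rewrite dE linearB pp subrr.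
  by rewrite dE pd !linear0 addr0.
have [d dE] : exists d : {linear E -> E}, forall e, d e = p (f (e - p e)).
  apply: linear_pack => a u v.
  have -> : a *: u + v - p (a *: u + v) = a *: (u - p u) + (v - p v).
    by rewrite (linearP p) opprD scalerBr addrACA.
  by rewrite (linearP f) (linearP p).
rewrite -dE; apply: square_zero_stable => // e.
have pd : p (d e) = d e by rewrite dE pp.
by rewrite dE pd subrr !linear0.
Qed.

(* The off-diagonal corners of an idempotent p fixing x and killing x' are
   square-zero; x' is used to reach the diagonal part p f x from outside. *)
Lemma square_stable (x x' : E) : M x -> M x' ->
  (forall a b : R, a *: x = b *: x' -> a *: x = 0) ->
  (forall a : R, a *: x' = 0 -> a *: x = 0) ->
  forall f : {linear E -> E}, M (f x).
Proof.
move=> Mx Mx' xx' ann f.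
have [_ [a <-] [b ba]|p [pX pY _ pp]] :=
  projection injE nsE (submod_cyclic x) (submod_cyclic x').
  by apply: (xx' a b).
have px : p x = x by apply: pX; exists 1; rewrite scale1r.
have px' : p x' = 0 by apply: pY; exists 1; rewrite scale1r.
have [|g gx'] := @ext_elem R E E x' (f x) injE.
  by move=> a /ann ax; rewrite -linearZ_LR ax linear0.
have [+ _] := corner_stable f pp Mx; have [_] := corner_stable g pp Mx'.
rewrite px px' subr0 gx' => M1 M2.
by rewrite -[f x](subrK (p (f x))); exact: HM.2.1.
Qed.

(** Let [p] project onto the closure of [R x]. The part of [f x] outside the image of [p] is handled
    by [corner_stable]. If [y = p (f x)] is non-zero, uniformity makes [p f p] invertible on the
    image of [p]; completed by the identity on the kernel, it is an automorphism sending [x] to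
    [y]. *)
Lemma uniform_stable (x : E) : M x ->
  (forall a b : R, a *: x <> 0 -> b *: x <> 0 ->
     exists c d : R, c *: (a *: x) = d *: (b *: x) /\ c *: (a *: x) <> 0) ->
  forall f : {linear E -> E}, M (f x).
Proof.
move=> Mx unif f.
have [//|p [pX _ pess pp]] :=
  projection injE nsE (submod_cyclic x) (submod0 E).
have px : p x = x by apply: pX; exists 1; rewrite scale1r.
have [+ _] := corner_stable f pp Mx; rewrite px => M1.
rewrite -[f x](subrK (p (f x))); apply: HM.2.1 => //.
set y := p (f x); have [->|y0] := pselect (y = 0); first exact: HM.1.
have py : p y = y by rewrite pp.
(* If [a] killed [y] but not [x], a non-zero element would be common to [R a x] and [R c x].
   Applying [p f] to it gives a zero multiple of [c *: y], and [cfree] forces the common element to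
   vanish. *)
have [|g gy] := @ext_elem R E E y x injE.
  move=> a ay; apply: contrapT => ax.
  have [c [cy cfree]] := nonsing_free nsE y0.
  have cx : c *: x <> 0.
    by move=> cx; apply: cy; rewrite -!linearZ_LR cx !linear0.
  have [d [e [ed dax]]] := unif a c ax cx.
  apply: dax; rewrite ed scalerA cfree ?scale0r //.
  by rewrite /y -!linearZ_LR -ed !linearZ_LR ay scaler0.
have [F FE] : exists F : {linear E -> E}, forall e, F e = p (f (p e)).
  by apply: linear_pack => a u v; rewrite !linearD !linearZ_LR.
have [G GE] : exists G : {linear E -> E}, forall e, G e = p (g (p e)).
  by apply: linear_pack => a u v; rewrite !linearD !linearZ_LR.
have pF e : p (F e) = F e by rewrite FE pp.
have pG e : p (G e) = G e by rewrite GE pp.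
have Fp e : F (p e) = F e by rewrite !FE pp.
have Gp e : G (p e) = G e by rewrite !GE pp.
have Fx : F x = y by rewrite FE px.
have Gy : G y = x by rewrite GE py gy px.
have GF e : G (F e) = p e.
  apply/eqP; rewrite -subr_eq0; apply/eqP; apply: (nonsing_kill nsE (pess e)).
  move=> r [s sx]; have GFr : r *: G (F (p e)) = G (F (r *: p e)).
    by rewrite !linearZ_LR.
  by rewrite -[F e]Fp scalerBr GFr -sx !linearZ_LR Fx Gy -scalerDr subrr scaler0.
(* The defect [q = F G - p] acts as -1 on its own image and kills [y]. If [q e] were non-zero,
   uniformity would give a non-zero common multiple of [q e] and [y], on which [q] is both -1 and
   0. *)
have FG e : F (G e) = p e.
  pose q u := F (G u) - p u.
  have qZ r u : q (r *: u) = r *: q u by rewrite /q !linearZ_LR scalerDr.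
  have pq u : p (q u) = q u by rewrite /q linearB pp pF.
  have qq u : q (q u) = - q u.
    have Gq : G (q u) = 0 by rewrite linearB GF pG Gp subrr.
    by rewrite -[q (q u)]/(F (G (q u)) - p (q u)) Gq linear0 add0r pq.
  have qy : q y = 0 by rewrite /q Gy Fx py subrr.
  apply/eqP; rewrite -subr_eq0; apply/eqP; apply: contrapT => qe0.
  have [|r [[s sx] rq0]] := projection_hit (pess (q e)); first by rewrite pq.
  have [|r' [[s' sx'] ry0]] := projection_hit (pess y); first by rewrite py.
  rewrite pq in sx rq0; rewrite py in sx' ry0.
  have [||c [d [cd]]] := unif s s'; first by rewrite sx.
    by rewrite sx'.
  apply; have : q (c *: (s *: x)) = 0 by rewrite cd sx' !qZ qy !scaler0.
  by rewrite sx -!qZ qq => /eqP; rewrite oppr_eq0 => /eqP.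
have [h hE] : exists h : {linear E -> E}, forall e, h e = e - p e + F e.
  apply: linear_pack => a u v.
  rewrite (linearP p) (linearP F) scalerDr scalerBr opprD.
  by rewrite [X in X + _ = _]addrACA [LHS]addrACA.
have -> : y = h x by rewrite hE px subrr add0r Fx.
apply: autM => //; exists (fun e => e - p e + G e) => e.
  rewrite hE !linearD !linearN pF pp subrr add0r GF Gp subrr add0r.
  by rewrite addrK subrK.
rewrite hE !linearD !linearN pG pp subrr add0r FG Fp subrr add0r.
by rewrite addrK subrK.
Qed.

Lemma aut_invariant_full :
  strongly_semiprime_mod_goldie R -> essential M -> forall e, M e.
Proof.
move=> ssp eM e; pose M0 u := forall f : {linear E -> E}, M (f u).
have HM0 : submod M0.
  split; first by move=> f; rewrite linear0; exact: HM.1.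
  split=> [u v Mu Mv f|r u Mu f]; first by rewrite linearD; exact: HM.2.1.
  by rewrite linearZ_LR; exact: HM.2.2.
(* [M0] is the largest fully invariant submodule of [M]. *)
have invM0 : fully_invariant M0.
  by split=> // f u Mu g; apply: (Mu (g \o f)).
suff eM0 : essential M0.
  exact: (fully_invariant_full ssp invM0 eM0 e idfun).
split=> // T HT nT; have [m [Mm [Tm m0]]] := eM.2 T HT nT.
apply: contrapT => NT.
have M0m a : M0 (a *: m) -> a *: m = 0.
  move=> Ma; apply: contrapT => am; apply: NT; exists (a *: m).
  by split=> //; split=> //; exact: HT.2.2.
have [//|p [pX _ pess _]] :=
  projection injE nsE (submod_cyclic m) (submod0 E).
have pm : p m = m by apply: pX; exists 1; rewrite scale1r.
(* [tr q] is the largest fully invariant submodule inside the kernel of [q]; [tr p] makes precise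
   orthogonality to [m]. *)
pose tr (q : {linear E -> E}) u := forall f : {linear E -> E}, q (f u) = 0.
have Htr q : submod (tr q).
  split; first by move=> f; rewrite !linear0.
  split=> [u v qu qv f|r u qu f]; first by rewrite !linearD qu qv addr0.
  by rewrite !linearZ_LR qu scaler0.
have invtr q (f : {linear E -> E}) u : tr q u -> tr q (f u).
  by move=> qu g; apply: (qu (g \o f)).
pose Phi (f : E -> E) := exists g : {linear E -> E}, f = g.
have [|N [[HN invN Nm trN] maxN]] := @zorn_avoid R E Phi (fun u => u = m) (tr p).
  split=> //; first by move=> _ u [g ->]; exact: invtr.
  by move=> u pu um; apply: m0; rewrite -pm -um; exact: (pu idfun).
suff eN : essential N.
  apply: (Nm m) => //; apply: (fully_invariant_full ssp _ eN).
  by split=> // f u; apply: invN; exists f.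
split=> // T' HT' [x [T'x x0]]; apply: contrapT => NT'.
have NT'0 u : T' u -> N u -> u = 0.
  by move=> T'u Nu; apply: contrapT => u0; apply: NT'; exists u.
have [f pfx] : exists f : {linear E -> E}, p (f x) <> 0.
  apply: contrapT => Nf; apply: x0; apply: NT'0 => //; apply: trN => f.
  by apply: contrapT => pf; apply: Nf; exists f.
have [r [[a am] rpf]] := projection_hit (pess (f x)) pfx.
rewrite -am in rpf; have [c [cam cfree]] := nonsing_free nsE rpf.
(* [m2] is a multiple of [m] for which [R m2] and [R (c r x)] are matched by endomorphisms in both
   directions. Since the latter lies in [T'], [R m2] meets [N] trivially. *)
set m2 := c *: (a *: m) in cam cfree.
have pf2 : p (f (c *: (r *: x))) = m2 by rewrite !linearZ_LR -am.
have [|g gm2] := @ext_elem R E E m2 (c *: (r *: x)) injE.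
  by move=> b /cfree bc; rewrite scalerA bc scale0r.
have Nm2 b : N (b *: m2) -> b *: m2 = 0.
  move=> Nb; rewrite -pf2 -!linearZ_LR (NT'0 (b *: _)) ?linear0 //.
    by do 3!apply: HT'.2.2.
  by rewrite -gm2 -linearZ_LR; apply: invN => //; exists g.
have Mm2 : M m2 by do 2!apply: HM.2.2.
have Rm2 b : M0 (b *: m2) -> b *: m2 = 0 by rewrite /m2 !scalerA; exact: M0m.
(* Otherwise [R m2] would be uniform and [uniform_stable] would put [m2] in [M0]. *)
have [a1 [a2 [am1 am2 indep]]] : exists a1 a2 : R, [/\ a1 *: m2 <> 0,
    a2 *: m2 <> 0 & forall b d : R, b *: (a1 *: m2) = d *: (a2 *: m2) ->
      b *: (a1 *: m2) = 0].
  apply: contrapT => Nu; apply: cam; rewrite -[m2]scale1r.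
  apply: Rm2; rewrite scale1r; apply: uniform_stable => // a1 a2 am1 am2.
  apply: contrapT => Ncd; apply: Nu; exists a1, a2; split=> // b d bd.
  by apply: contrapT => b0; apply: Ncd; exists b, d.
have [z [b zb] [n [w [Nn [d wd] bnd]]]|q [qX qY qess _]] :=
  projection injE nsE (submod_cyclic (a2 *: m2))
    (submod_add HN (submod_cyclic (a1 *: m2))).
  rewrite -zb -wd in bnd *; have n0 : n = 0.
    have nE : n = (b * a2 - d * a1) *: m2.
      by rewrite scalerBl -!scalerA bnd addrK.
    by rewrite nE; apply: Nm2; rewrite -nE.
  by rewrite n0 add0r in bnd; rewrite bnd (indep d b).
have Ntr u : N u -> tr q u.
  move=> Nu h; apply: qY; exists (h u), 0; rewrite addr0; split=> //.
    by apply: invN => //; exists h.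
  by exists 0; rewrite scale0r.
(* [tr q] contains [N] but not [m], so maximality gives [tr q = N]. It remains to place [a1 *: m2]
   in [tr q], which contradicts [Nm2]. *)
apply: am1; apply: Nm2; apply: (maxN (tr q)) => //.
  split=> //; first by move=> _ u [h ->]; exact: invtr.
    move=> u qu um; apply: am2; rewrite -(qX (a2 *: m2)); last first.
      by exists 1; rewrite scale1r.
    by rewrite !linearZ_LR -um (qu idfun) !scaler0.
  by move=> u /trN /Ntr.
move=> h; apply: contrapT => qh.
(* A non-zero multiple [d a2 m2] would be the image of [r' a1 m2] under [q h]; the two generate
   independent submodules, so [square_stable] puts the former in [M0]. *)
have [r' [[d dE] rq0]] := projection_hit (qess (h (a1 *: m2))) qh.
apply: rq0; rewrite -dE scalerA; apply: Rm2; rewrite -scalerA.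
apply: (@square_stable _ (r' *: (a1 *: m2))).
- by do 2!apply: HM.2.2.
- by do 2!apply: HM.2.2.
- move=> b b' bE; have := indep (b' * r') (b * d).
  by rewrite -(scalerA b') -(scalerA b) bE; apply.
- by move=> b br; rewrite dE -!linearZ_LR br !linear0.
Qed.

End AutInvariant.
End FullyInvariant.

(** * Germs of homomorphisms from essential left ideals to [M] *)

Section PartialMaps.
Variables (R : pzRingType) (M : lmodType R).
Hypothesis nsM : nonsingular M.

(** Functions are total and carry no domain: values off an essential left ideal are arbitrary and
    disappear in [germ]. *)
Definition partial_map := R -> M.
HB.instance Definition _ := gen_eqMixin partial_map.
HB.instance Definition _ := gen_choiceMixin partial_map.

Let add (f g : partial_map) : partial_map := fun b => f b + g b.
Let opp (f : partial_map) : partial_map := fun b => - f b.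
Let addA : associative add.
Proof. by move=> f g h; apply/funext => b; rewrite /add addrA. Qed.
Let addC : commutative add.
Proof. by move=> f g; apply/funext => b; rewrite /add addrC. Qed.
Let add0 : left_id (fun=> 0) add.
Proof. by move=> f; apply/funext => b; rewrite /add add0r. Qed.
Let addN : left_inverse (fun=> 0) opp add.
Proof. by move=> f; apply/funext => b; rewrite /add /opp addNr. Qed.
HB.instance Definition _ := GRing.isZmodule.Build partial_map addA addC add0 addN.

Definition linear_on (I : R^o -> Prop) (f : R -> M) :=
  (forall b c : R, I b -> I c -> f (b + c) = f b + f c) /\
  (forall a b : R, I b -> f (a * b) = a *: f b).

Definition dense (f : partial_map) := exists I : R^o -> Prop, essential I /\ linear_on I f.
Definition dense_pred : {pred partial_map} := [pred f | `[<dense f>]].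

Let essentialT : essential (fun _ : R^o => True).
Proof. by split=> // T HT [t [Tt t0]]; exists t. Qed.

Let dense_pred_closed : zmod_closed dense_pred.
Proof.
split=> [|f g]; first apply/asboolP.
  by exists (fun=> True); split=> //; split=> [b c _ _|a b _]; rewrite ?addr0 ?scaler0.
move=> /asboolP [I [eI [fD fZ]]] /asboolP [J [eJ [gD gZ]]].
apply/asboolP; exists (fun r => I r /\ J r); split; first exact: essential_cap.
split=> [b c [Ib Jb] [Ic Jc]|a b [Ib Jb]]; rewrite -![(f - g) _]/(f _ - g _).
  by rewrite fD // gD // opprD addrACA.
by rewrite fZ // gZ // scalerBr.
Qed.
HB.instance Definition _ :=
  GRing.isZmodClosed.Build partial_map dense_pred dense_pred_closed.

Definition dmap := {f | dense_pred f}.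
Let mk f (df : dense_pred f) : dmap := exist (fun g : partial_map => dense_pred g) f df.
HB.instance Definition _ := SubChoice.on dmap.
HB.instance Definition _ := [SubChoice_isSubZmodule of dmap by <:].

Definition negl : {pred dmap} :=
  [pred u | `[<exists I : R^o -> Prop, essential I /\ forall b : R, I b -> val u b = 0>]].

Let negl_closed : zmod_closed negl.
Proof.
split=> [|f g]; first by apply/asboolP; exists (fun=> True).
move=> /asboolP [I [eI fI]] /asboolP [J [eJ gJ]]; apply/asboolP.
exists (fun r => I r /\ J r); split=> [|b [Ib Jb]]; first exact: essential_cap.
by rewrite -[LHS]/(val f b - val g b) fI // gJ // subrr.
Qed.
HB.instance Definition _ := GRing.isZmodClosed.Build dmap negl negl_closed.

Definition germ := Quotient.quot negl.
Local Notation Q := germ.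
HB.instance Definition _ := GRing.Zmodule.on germ.

Let piP (u v : dmap) (I : R^o -> Prop) : essential I ->
  (forall b : R, I b -> val u b = val v b) -> \pi_Q u = \pi_Q v.
Proof.
move=> eI uv; apply/eqP; rewrite -Quotient.idealrBE; apply/asboolP.
by exists I; split=> // b Ib; rewrite -[LHS]/(val u b - val v b) uv // subrr.
Qed.

Let pi_eq (u v : dmap) : \pi_Q u = \pi_Q v ->
  exists I : R^o -> Prop, essential I /\ forall b : R, I b -> val u b = val v b.
Proof.
move=> /eqP; rewrite -Quotient.idealrBE => /asboolP [I [eI uv]].
exists I; split=> // b /uv /eqP.
by rewrite -[X in X == _]/(val u b - val v b) subr_eq0 => /eqP.
Qed.

(** Scalars act by right translation of the argument; the translate is linear on the left ideal of
    all [b] with [b * a] in [I]. *)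
Let scale_dense (a : R) (u : dmap) : dense_pred (fun b => val u (b * a)).
Proof.
case: u => f /= /asboolP [I [eI [fD fZ]]]; apply/asboolP.
exists (fun b : R^o => I ((b : R) *: (a : R^o))); split; first exact: essential_colon.
by split=> [b c Ib Ic|r b Ib]; rewrite ?mulrDl ?fD // -mulrA fZ.
Qed.

Let scale (a : R) (u : dmap) : dmap := mk (scale_dense a u).
Let scaleQ (a : R) (q : Q) : Q := \pi_Q (scale a (repr q)).

Let piZ a u : scaleQ a (\pi_Q u) = \pi_Q (scale a u).
Proof.
have [I [eI ru]] := pi_eq (reprK (\pi_Q u)).
by apply: (piP (essential_colon (X := R^o) a eI)) => b /ru.
Qed.

Let piD u v : \pi_Q u + \pi_Q v = \pi_Q (u + v).
Proof. by rewrite raddfD. Qed.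

Let scaleQA a b v : scaleQ a (scaleQ b v) = scaleQ (a * b) v.
Proof.
elim/quotW: v => v; rewrite (piZ b v) !piZ; apply: (piP essentialT) => c _ /=.
by rewrite mulrA.
Qed.
Let scaleQ1 : left_id 1 scaleQ.
Proof.
move=> q; elim/quotW: q => v; rewrite piZ; apply: (piP essentialT) => c _ /=.
by rewrite mulr1.
Qed.
Let scaleQDr : right_distributive scaleQ +%R.
Proof.
move=> a p q; elim/quotW: p => u; elim/quotW: q => v.
by rewrite piD !piZ piD; apply: (piP essentialT).
Qed.
Let scaleQDl q : {morph scaleQ^~ q : a b / a + b}.
Proof.
elim/quotW: q => u a b; rewrite !piZ piD.
have /asboolP [I [eI [uD _]]] := valP u.
apply: (piP (essential_cap (essential_colon (X := R^o) a eI)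
                           (essential_colon (X := R^o) b eI))) => c [Ia Ib] /=.
by rewrite mulrDr uD.
Qed.
HB.instance Definition _ :=
  GRing.Zmodule_isLmodule.Build R Q scaleQA scaleQ1 scaleQDr scaleQDl.

Let cst_dense (m : M) : dense_pred (fun b => b *: m).
Proof.
apply/asboolP; exists (fun=> True); split=> //.
by split=> [b c _ _|a b _]; rewrite ?scalerDl ?scalerA.
Qed.

(** An element [m] becomes the germ of [b |-> b *: m]. For [a] in the domain of [f],
    [f (b * a) = b *: f a], so [a] times the germ of [f] is the image of [f a]. *)
Lemma partial_maps_exist :
  exists (E : lmodType R) (i : {linear M -> E}),
  [/\ injective i,
      forall q : E, exists (I : R^o -> Prop) (f : R -> M), essential I /\
        forall a : R, I a -> a *: q = i (f a),
      forall (I : R^o -> Prop) (f : R -> M), essential I -> linear_on I f ->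
        exists q : E, forall a : R, I a -> a *: q = i (f a) &
      forall (q : E) (I : R^o -> Prop), essential I ->
        (forall a : R, I a -> a *: q = 0) -> q = 0].
Proof.
pose cst m : dmap := mk (cst_dense m).
have piZE a u : a *: (\pi_Q u : Q) = \pi_Q (scale a u) by exact: piZ.
have [i iE] : exists i : {linear M -> Q}, forall m, i m = \pi_Q (cst m).
  apply: linear_pack => a m n; rewrite piZE piD.
  by apply: (piP essentialT) => b _ /=; rewrite scalerDr scalerA.
have i_inj : injective i.
  move=> m n; rewrite !iE => /pi_eq [I [eI mn]].
  apply/eqP; rewrite -subr_eq0; apply/eqP; apply: (nonsing_kill nsM eI) => r /mn /= rmn.
  by rewrite scalerBr rmn subrr.
have scaleE u I : linear_on I (val u) ->
    forall a : R, I a -> a *: (\pi_Q u : Q) = i (val u a).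
  move=> [uD uZ] a Ia; rewrite iE piZE.
  by apply: (piP essentialT) => b _ /=; rewrite uZ.
exists Q, i; split=> // [q|I f eI fI|q I eI].
- elim/quotW: q => u; have /asboolP [I [eI uI]] := valP u.
  by exists I, (val u); split=> //; exact: scaleE.
- have df : dense_pred f by apply/asboolP; exists I.
  by exists (\pi_Q (mk df)) => a Ia; exact: (scaleE (mk df) I fI a Ia).
- elim/quotW: q => u Iu; have /asboolP [J [eJ uJ]] := valP u.
  rewrite -(raddf0 \pi_Q); apply: (piP (essential_cap eI eJ)) => b [Ib Jb].
  by apply: i_inj; rewrite -[X in _ = i X]/(0 : M) linear0 -(scaleE _ J) // Iu.
Qed.
End PartialMaps.

Lemma linear_inj (R : pzRingType) (X Y : lmodType R) (f : {linear X -> Y}) :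
  (forall x, f x = 0 -> x = 0) -> injective f.
Proof.
move=> f0 x y fxy; apply/eqP; rewrite -subr_eq0; apply/eqP/f0.
by rewrite linearB fxy subrr.
Qed.

(* For non-singular M the hull is the direct limit of Hom(I, M) over the
   essential ideals I, although these need not form a Gabriel filter. *)
Lemma nonsingular_hull (R : pzRingType) (M : lmodType R) : nonsingular M ->
  exists (E : lmodType R) (i : {linear M -> E}), injective_hull i /\ nonsingular E.
Proof.
move=> nsM; have [E [i [i_inj Edom Eext E0]]] := partial_maps_exist nsM.
have nsE : nonsingular E by move=> q sq; apply: (E0 q _ sq).
exists E, i; split=> //; split; last first.
  split=> //; split; first exact: submod_img.
  move=> T HT [q [Tq q0]]; have [I [f [eI fI]]] := Edom q.
  apply: contrapT => NT; apply: q0; apply: (E0 q I eI) => a Ia.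
  apply: contrapT => aq0; apply: NT; exists (a *: q); split.
    by exists (f a); rewrite fI.
  by split=> //; exact: HT.2.2.
apply: baer => V HV fV; have [W [HW fW VW maxW]] := max_functional HV fV.
pose J (r : R^o) := exists v, W (r, v).
(* A left ideal meeting the domain [J] trivially could be adjoined to it with value 0, against
   maximality. *)
have eJ : essential J.
  split.
    split; first by exists 0; exact: HW.1.
    split=> [r s [v Wv] [w Ww]|a r [v Wv]].
      by exists (v + w); exact: (HW.2.1 _ _ Wv Ww).
    by exists (a *: v); exact: (HW.2.2 a _ Wv).
  move=> T HT [t [Tt t0]]; apply: contrapT => NJ.
  have TJ r : T r -> J r -> r = 0.
    by move=> Tr Jr; apply: contrapT => r0; apply: NJ; exists r.
  pose T0 (p : R^o * E) := T p.1 /\ p.2 = 0.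
  have HT0 : submod T0.
    split; first by split=> //; exact: HT.1.
    split=> [x y [Tx x0] [Ty y0]|r x [Tx x0]].
      by split; [exact: HT.2.1|rewrite /= x0 y0 addr0].
    by split; [exact: HT.2.2|rewrite /= x0 scaler0].
  apply: t0; apply: (TJ) => //; exists 0.
  apply: (maxW (fun x => exists u v, [/\ W u, T0 v & x = u + v])).
  - exact: submod_add.
  - move=> v [[r w] [[s z] [Wrw [/= Ts ->] /pair_equal_spec [/= rs ->]]]].
    have rE : r = - s by apply/eqP; rewrite -addr_eq0 -rs.
    have r0 : r = 0.
      by apply: TJ; [rewrite rE; exact: submodN|exists w].
    by rewrite addr0; apply: fW; rewrite -r0.
  - by move=> x Wx; exists x, 0; rewrite addr0; split=> //; exact: HT0.1.
  - by exists 0, (t, 0); rewrite add0r; split=> //; exact: HW.1.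
(* On [K] the values of [W] lie in [M], so there [W] is a partial map that [Eext] can represent. *)
pose K (r : R^o) := exists m, W (r, i m).
have eK : essential K.
  split.
    split; first by exists 0; rewrite linear0; exact: HW.1.
    split=> [r s [m Wm] [n Wn]|a r [m Wm]].
      by exists (m + n); rewrite linearD; exact: (HW.2.1 _ _ Wm Wn).
    by exists (a *: m); rewrite linearZ_LR; exact: (HW.2.2 a _ Wm).
  move=> T HT /(eJ.2 T HT) [t [[v Wv] [Tt t0]]].
  have [I [f [eI fI]]] := Edom v.
  (* Either a multiple [b *: t] with [b] in [I] is non-zero and lies in [K], or [I] kills [t], hence
     also [v]; then [v = 0] and [t] itself is in [K]. *)
  have [[b [Ib bt]]|Nb] := pselect (exists b : R, I b /\ b *: t <> 0).
    exists (b *: t); split; last by split=> //; exact: HT.2.2.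
    by exists (f b); rewrite -fI //; exact: (HW.2.2 b _ Wv).
  exists t; split=> //; exists 0; rewrite linear0 -(E0 v I eI) // => b Ib.
  apply: fW; have -> : 0 = b *: t.
    by apply: contrapT => bt; apply: Nb; exists b; split=> // /esym.
  exact: (HW.2.2 b _ Wv).
have [|h hW] := @choice R M (fun r m => K r -> W (r, i m)).
  by move=> r; have [[m Wm]|NK] := pselect (K r); [exists m|exists 0].
have Weq r u v := @functional_eq _ _ _ W r u v HW fW.
have hK : linear_on K h.
  split=> [b c Kb Kc|a b Kb]; apply: i_inj.
    rewrite linearD; apply: (Weq (b + c)); last exact: (HW.2.1 _ _ (hW b Kb) (hW c Kc)).
    by apply: hW; exact: eK.1.2.1.
  rewrite linearZ_LR; apply: (Weq (a * b)); last exact: (HW.2.2 a _ (hW b Kb)).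
  by apply: hW; exact: eK.1.2.2.
have [q qK] := Eext K h eK hK.
(* The equation [v = r *: q] is tested on the essential left ideal of all [b] with [b * r] in
   [K]. *)
exists q => r v /VW Wv; apply/eqP; rewrite -subr_eq0; apply/eqP.
apply: (E0 _ _ (essential_colon (X := R^o) (r : R^o) eK)) => b Kbr.
rewrite scalerBr scalerA qK //; apply/eqP; rewrite subr_eq0; apply/eqP.
by apply: (Weq (b * r)); [exact: (HW.2.2 b _ Wv)|exact: hW].
Qed.

(** * The Goldie radical and the two implications over [R] *)

Section GoldieRadical.
Variable R : pzRingType.

Lemma goldie_submod (X : lmodType R) : submod (@goldie_rad R X).
Proof.
split; first by move=> Y HY _; exact: HY.1.
split=> [x y Gx Gy|r x Gx] Y HY nY.
  by apply: HY.2.1; [exact: Gx|exact: Gy].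
by apply: HY.2.2; exact: Gx.
Qed.

Lemma goldie_quot_nonsingular (X : lmodType R) : quot_nonsingular (@goldie_rad R X).
Proof.
move=> x ex Y HY nY; apply: (nY); apply: essential_sub ex _ _.
  exact: submod_colon.
by move=> r Gr; exact: Gr.
Qed.

(** For multiplication by [a] on the right, the preimage of [Y] under [r |-> r * a] again has a
    non-singular quotient, so it contains [x]. *)
Lemma goldie_two_sided : two_sided_ideal (fun a : R => goldie_rad (X := R^o) a).
Proof.
have [G0 [GD GZ]] := goldie_submod R^o.
split=> //; split=> //; split=> [a x Gx|a x Gx]; first exact: GZ.
move=> Y HY nY; apply: (Gx (fun r : R^o => Y ((r : R) *: (a : R^o)))).
  exact: (submod_colon (X := R^o) (a : R^o) HY).
move=> r er; apply: nY; move: er; congr essential.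
by apply/funext => b; rewrite scalerA.
Qed.

Lemma quotient_nonsingular (X Q : lmodType R) (p : {linear X -> Q}) (S : X -> Prop) :
  (forall q, exists x, p x = q) -> (forall x, p x = 0 <-> S x) ->
  quot_nonsingular S -> nonsingular Q.
Proof.
move=> psurj pker nS q; have [x <-] := psurj q => sx; apply/pker/nS.
move: sx; congr essential; apply/funext => r; apply/propext.
by rewrite -linearZ_LR; exact: pker.
Qed.

(** By [aut_invariant_full], [M] fills its hull [E], and extensions into [E] are pulled back along
    [i]. *)
Lemma injective_of_strongly_semiprime (M : lmodType R) :
  strongly_semiprime_mod_goldie R -> auto_invariant M -> nonsingular M ->
  injective_mod M.
Proof.
move=> ssp autM nsM; have [E [i [hullE nsE]]] := nonsingular_hull nsM.
have [injE [i_inj ei]] := hullE.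
have isurj : forall e, exists m, i m = e.
  apply: (aut_invariant_full injE nsE (submod_img i) _ ssp ei).
  by move=> g gbij _ [m <-]; have [m' ->] := autM E i hullE g gbij m; exists m'.
move=> X Y j f j_inj; have [h hj] := injE X Y j (i \o f) j_inj.
have [k kE] := choice (fun y => isurj (h y)).
have [g gE] : exists g : {linear Y -> M}, forall y, g y = k y.
  by apply: linear_pack => a u v; apply: i_inj; rewrite !(kE, linearP).
by exists g => x; rewrite gE; apply: i_inj; rewrite kE hj.
Qed.

Lemma strongly_semiprime_of_injective :
  (forall M : lmodType R, auto_invariant M -> nonsingular M -> injective_mod M) ->
  strongly_semiprime_mod_goldie R.
Proof.
move=> inj I HI GI eI.
have [Q [p [psurj pker]]] := quotient_exists (goldie_submod R^o).
have nsQ := quotient_nonsingular psurj pker (@goldie_quot_nonsingular R^o).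
have [E [f [[injE [f_inj ef]] nsE]]] := nonsingular_hull nsQ.
pose u := f (p 1).
have uG (b : R) : b *: u = 0 -> goldie_rad (X := R^o) b.
  move=> bu; have -> : b = b *: (1 : R^o) by rewrite -[RHS]/(b * 1) mulr1.
  by apply/pker/f_inj; rewrite linear0 !linearZ_LR.
(* [IE] is the submodule [I E], given as an intersection so that membership is used by choosing
   [S]. *)
pose IE (y : E) := forall S : E -> Prop, submod S ->
  (forall x e, I x -> S (x *: e)) -> S y.
have HIE : submod IE.
  split; first by move=> S HS _; exact: HS.1.
  split=> [x y IEx IEy|r x IEx] S HS SI.
    by apply: HS.2.1; [exact: IEx|exact: IEy].
  by apply: HS.2.2; exact: IEx.
have IEf (g : {linear E -> E}) y : IE y -> IE (g y).
  move=> IEy S HS SI; apply: (IEy (fun z => S (g z))); first exact: submod_preim.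
  by move=> x e Ix; rewrite linearZ_LR; exact: SI.
have eIE : essential IE.
  split=> // T HT [e [Te e0]]; apply: contrapT => NT; apply: e0.
  apply: (nonsing_kill nsE eI) => r Ir; apply: contrapT => re0; apply: NT.
  by exists (r *: e); split; [move=> S _; apply|split=> //; exact: HT.2.2].
have [M [j [j_inj jIE]]] := submodule_exists HIE.
have autM : auto_invariant M.
  move=> E' f' [injE' [f'_inj ef']] g _ m.
  (* The arbitrary hull [E'] is compared with [E]: [be] is injective since its kernel misses the
     essential image of [f'], and [be g al] is an endomorphism of [E], so it preserves [IE]. *)
  have [al alj] := injE' _ _ j f' j_inj.
  have [be bef] := injE _ _ f' j f'_inj.
  have be_inj : injective be.
    apply: linear_inj => e be0; apply: contrapT => e0.
    have [|x [[n nx] [bx x0]]] := ef'.2 _ (submod_ker be).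
      by exists e.
    apply: x0; rewrite -nx; rewrite -nx bef in bx.
    by rewrite (_ : n = 0) ?linear0 //; apply: j_inj; rewrite bx linear0.
  have /jIE [m' jm'] : IE (be (g (al (j m)))).
    by apply: (IEf (be \o g \o al)); apply/jIE; exists m.
  by exists m'; apply: be_inj; rewrite bef jm' alj.
(* Injectivity of [M] gives a retraction [r] of [E] onto [M]; its kernel misses the essential [IE],
   so [r] is injective and [IE] is all of [E]. *)
have [r rj] := inj M autM (nonsing_sub nsE j_inj) M E j idfun j_inj.
have r_inj : injective r.
  apply: linear_inj => e re0; apply: contrapT => e0.
  have [|x [/jIE [n nx] [rx x0]]] := eIE.2 _ (submod_ker r).
    by exists e.
  by apply: x0; rewrite -nx; rewrite -nx rj in rx; rewrite [n]rx linear0.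
have IEu : IE u by apply/jIE; exists (r u); apply: r_inj; rewrite rj.
(* The finite subset is extracted by choosing [S = fin]: the elements killed by every [b] that
   annihilates some fixed finite subset of [I] modulo the radical. *)
pose fin (y : E) := exists s : seq R, (forall x, x \in s -> I x) /\
  forall b : R, (forall x, x \in s -> goldie_rad (X := R^o) (b * x)) -> b *: y = 0.
have [||s [sI su]] := IEu fin; last by exists s; split=> // b /su; exact: uG.
  split; first by exists [::]; split=> // b _; rewrite scaler0.
  split=> [x y [s [sI sx]] [t [tI ty]]|a x [s [sI sx]]].
    exists (s ++ t); split=> [z|b bst]; first by rewrite mem_cat => /orP[/sI|/tI].
    rewrite scalerDr sx ?ty ?addr0 // => z zs; apply: bst; rewrite mem_cat zs ?orbT //.
  exists [seq a * z | z <- s]; split=> [_ /mapP [z /sI Iz ->]|b bs].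
  by have [_ [_ [IZ _]]] := HI; exact: IZ.
  rewrite scalerA; apply: sx => z zs; rewrite -mulrA; apply: bs.
  exact: map_f.
move=> x e Ix; exists [:: x]; split=> [y|b bx].
  by rewrite inE => /eqP ->.
rewrite scalerA; apply: (goldie_kill nsE); apply: bx.
by rewrite mem_head.
Qed.

End GoldieRadical.

(** * Transfer between [A^c] and the factor ring [B] *)

Section FactorRing.
Variables (A B : pzRingType) (pi : {rmorphism A -> B}).
Hypothesis pi_surj : forall b : B, exists a : A, pi a = b.
Hypothesis pi_ker : forall a : A, pi a = 0 <-> goldie_rad (X := (A^c)^o) a.

Lemma factor_essential_preim (I : B -> Prop) :
  essential (fun b : (B^c)^o => I b) -> essential (fun a : (A^c)^o => I (pi a)).
Proof.
move=> [[I0 [ID IZ]] eI]; split.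
  split; first by rewrite rmorph0.
  split=> [x y Ix Iy|r x Ix]; first by rewrite rmorphD; exact: ID.
  by rewrite -[r *: x]/((x : A) * (r : A)) rmorphM; exact: (IZ (pi r)).
move=> T HT [t [Tt t0]].
have [[a [Ta pa]]|NT] := pselect (exists a, T a /\ pi a <> 0); last first.
  exists t; split=> //; have -> : pi t = 0; last exact: I0.
  by apply: contrapT => pt; apply: NT; exists t.
have [||d [Ib [[c [Tc cd]] c0]]] := eI (fun b => exists a, T a /\ pi a = b).
- split; first by exists 0; rewrite rmorph0; split=> //; exact: HT.1.
  split=> [_ _ [x [Tx <-]] [y [Ty <-]]|r _ [x [Tx <-]]].
    by exists (x + y); rewrite rmorphD; split=> //; exact: HT.2.1.
  have [s <-] := pi_surj r; exists ((x : A) * s); rewrite rmorphM; split=> //.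
  exact: (HT.2.2 s).
- by exists (pi a); split=> //; exists a.
rewrite -cd in Ib c0; exists c; split=> //; split=> // c00.
by apply: c0; rewrite c00 rmorph0.
Qed.

(** If the right ideal generated by [b = pi t] missed the image of [I], an essential right ideal
    would carry [t] into the radical; its quotient being non-singular, [t] would lie in it and [b]
    would be 0. *)
Lemma factor_essential_img (I : A -> Prop) :
  (forall a, goldie_rad (X := (A^c)^o) a -> I a) ->
  essential (fun a : (A^c)^o => I a) ->
  essential (fun b : (B^c)^o => exists a, I a /\ pi a = b).
Proof.
move=> GI eI; have [[I0 [ID IZ]] _] := eI; split.
  split; first by exists 0; rewrite rmorph0.
  split=> [_ _ [x [Ix <-]] [y [Iy <-]]|r _ [x [Ix <-]]].
    by exists (x + y); rewrite rmorphD; split=> //; exact: ID.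
  have [s <-] := pi_surj r; exists ((x : A) * s); rewrite rmorphM; split=> //.
  exact: (IZ s).
move=> T HT [b [Tb b0]]; have [t tb] := pi_surj b.
apply: contrapT => NT; apply: b0; rewrite -tb.
apply/pi_ker; apply: (@goldie_quot_nonsingular _ _ (t : (A^c)^o)).
apply: essential_sub (essential_colon (X := (A^c)^o) (t : (A^c)^o) eI) _ _.
  exact: (submod_colon (X := (A^c)^o) _ (goldie_submod _)).
move=> r Itr; apply/pi_ker; apply: contrapT => tr0; apply: NT.
exists (pi (t * r)); split; first by exists (t * r).
split; last exact: tr0.
by rewrite rmorphM tb; exact: (HT.2.2 (pi r) b Tb).
Qed.

Lemma factor_strongly_semiprime :
  strongly_semiprime_mod_goldie (A^c) <-> right_strongly_semiprime B.
Proof.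
split=> ssp I HI.
  move=> eI; have [I0 [ID [IZl IZr]]] := HI.
  have [||s [sI sG]] := ssp (fun a => I (pi a)) _ _ (factor_essential_preim eI).
  - split; first by rewrite rmorph0.
    split; first by move=> x y Ix Iy; rewrite rmorphD; exact: ID.
    split=> a x Ix.
      by rewrite -[a * x]/((x : A) * (a : A)) rmorphM; exact: IZr.
    by rewrite -[x * a]/((a : A) * (x : A)) rmorphM; exact: IZl.
  - by move=> a /pi_ker ->.
  exists (map pi s); split=> [_ /mapP [x /sI Ix ->] //|b bs].
  have [a ab] := pi_surj b; rewrite -ab; apply/pi_ker; apply: sG => x xs.
  by apply/pi_ker; rewrite rmorphM ab; apply: bs; exact: map_f.
move=> GI eI; have [I0 [ID [IZl IZr]]] := HI.
have [|s [sI sB]] := ssp (fun b => exists a, I a /\ pi a = b) _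
  (factor_essential_img GI eI).
  split; first by exists 0; rewrite rmorph0.
  split=> [_ _ [x [Ix <-]] [y [Iy <-]]|].
    by exists (x + y); rewrite rmorphD; split=> //; exact: ID.
  split=> r _ [x [Ix <-]]; have [a <-] := pi_surj r.
    by exists (a * x); rewrite rmorphM; split=> //; exact: (IZr a).
  by exists ((x : A) * a); rewrite rmorphM; split=> //; exact: (IZl a).
have [g gE] := choice pi_surj.
exists (map g s); split=> [_ /mapP [b /sI [a [Ia ab]] ->]|b bs].
  (* The chosen lift [g b] need not be [a], but it differs from it by an element of the kernel,
     which [I] contains. *)
  rewrite -[g b](subrK a); apply: ID => //; apply/GI/pi_ker.
  by rewrite rmorphB gE ab subrr.
apply/pi_ker/sB => x xs; rewrite -(gE x) -rmorphM; apply/pi_ker; apply: bs.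
exact: map_f.
Qed.
End FactorRing.

(* (2) is stated for every ring B with a surjective ring morphism A -> B whose
   kernel is G(A_A), i.e. for (any copy of) the factor ring A / G(A_A). *)
Theorem theorem1p3 (A : pzRingType) :
  (forall M : lmodType (A^c), auto_invariant M -> nonsingular M -> injective_mod M)
  <->
  (forall (B : pzRingType) (pi : {rmorphism A -> B}),
     (forall b : B, exists a : A, pi a = b) ->
     (forall a : A, pi a = 0 <-> goldie_rad (X := (A^c)^o) a) ->
     right_strongly_semiprime B).
Proof.
split=> [inj B pi pi_surj pi_ker|ssp M].
  apply/(factor_strongly_semiprime pi_surj pi_ker).
  exact: strongly_semiprime_of_injective.
apply: injective_of_strongly_semiprime.
have HG : two_sided_ideal (fun a : A => goldie_rad (X := (A^c)^o) a).
  by have [G0 [GD [Gl Gr]]] := goldie_two_sided (A^c).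
have [B [pi [pi_surj pi_ker]]] := quotient_ring_exists HG.
exact/(factor_strongly_semiprime pi_surj pi_ker)/(ssp B pi).
Qed.
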